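(* Let $k\ge 0$ and $m$ be integers with $k<m$. Then the complex algebra $A=\mathrm{IDD}(K^k_\infty,m,0)$ (defined in the context) is simple and conservative, and it is neither commutative nor anticommutative.
   Context: For integers $0\le k<m$, $\mathrm{IDD}(K^k_\infty,m,0)$ is the complex algebra with basis $e_k,e_{k+1},e_{k+2},\ldots$ (where $e_i$ stands for the monomial $x^i$) and bilinear multiplication $e_i\diamond e_j=\frac{i!}{(i-m)!}e_{i+j-m}$ if $i\ge m$, and $e_i\diamond e_j=0$ if $i<m$ (i.e. $f\diamond g=\partial^m(f)\,g$). An algebra is simple if it has nonzero multiplication and its only two-sided ideals are $0$ and itself. A vector space $V$ with bilinear multiplication (written by juxtaposition) is a conservative algebra if there is a bilinear multiplication $*:V\times V\to V$ such that for all $a,b,x,y\in V$: $$b\big(a(xy)-(ax)y-x(ay)\big)-a\big((bx)y\big)+\big(a(bx)\big)y+(bx)(ay)-a\big(x(by)\big)+(ax)(by)+x\big(a(by)\big)=-(a*b)(xy)+\big((a*b)x\big)y+x\big((a*b)y\big).$$ *)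

(* Defs.v *)
From HB Require Import structures.
From mathcomp Require Import all_boot all_order all_algebra.
From mathcomp Require Import boolp classical_sets reals.
From mathcomp Require Import complex.

Set Implicit Arguments.
Unset Strict Implicit.
Unset Printing Implicit Defensive.

Import GRing.Theory.
Local Open Scope classical_set_scope.
Local Open Scope ring_scope.

(* An algebra (not assumed associative, commutative or unital) over F is a
   vector space V together with a bilinear map V -> V -> V. *)
Section Algebras.
Context {F : fieldType} {V : lmodType F}.
Implicit Type mu : {bilinear V -> V -> V}.

Definition ideal mu (I : set V) : Prop :=
  [/\ I 0,
      forall (c : F) (u v : V), I u -> I v -> I (c *: u + v)
    & forall u v : V, I v -> I (mu u v) /\ I (mu v u)].

Definition simple_alg mu : Prop :=
  (exists u v : V, mu u v <> 0) /\
  (forall I : set V, ideal mu I -> I = [set 0] \/ I = [set: V]).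

Definition conservative_alg mu : Prop :=
  exists star : {bilinear V -> V -> V},
    forall a b x y : V,
      mu b (mu a (mu x y) - mu (mu a x) y - mu x (mu a y))
        - mu a (mu (mu b x) y) + mu (mu a (mu b x)) y + mu (mu b x) (mu a y)
        - mu a (mu x (mu b y)) + mu (mu a x) (mu b y) + mu x (mu a (mu b y))
      = - mu (star a b) (mu x y) + mu (mu (star a b) x) y
        + mu x (mu (star a b) y).

Definition anticommutative_alg mu : Prop := forall u v : V, mu u v = - mu v u.

End Algebras.

(* The space with basis e_k, e_(k+1), ...: the polynomials all of whose
   monomials have degree at least k, e_i being 'X^i. *)
Section Carrier.
Variables (F : fieldType) (k : nat).

Definition lowfree : {pred {poly F}} := fun p => [forall i : 'I_k, p`_i == 0].

Lemma lowfreeP (p : {poly F}) :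
  reflect (forall i, (i < k)%N -> p`_i = 0) (p \in lowfree).
Proof.
apply: (iffP forallP) => [h i ik|h i]; last by rewrite h.
exact/eqP/(h (Ordinal ik)).
Qed.

Lemma lowfree_submod_closed : submod_closed lowfree.
Proof.
split=> [|c p q /lowfreeP hp /lowfreeP hq]; apply/lowfreeP => i ik.
  by rewrite coef0.
by rewrite coefD coefZ hp // hq // mulr0 addr0.
Qed.

HB.instance Definition _ :=
  GRing.isSubmodClosed.Build F {poly F} lowfree lowfree_submod_closed.

Record Kinf := MkKinf { Kval :> {poly F}; KvalP : Kval \in lowfree }.

HB.instance Definition _ := [isSub for Kval].
HB.instance Definition _ := [Choice of Kinf by <:].
HB.instance Definition _ := [SubChoice_isSubLmodule of Kinf by <:].

Lemma lowfree_Xn i : (k <= i)%N -> 'X^i \in lowfree.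
Proof.
move=> ki; apply/lowfreeP => j jk; rewrite coefXn.
by rewrite (ltn_eqF (leq_trans jk ki)).
Qed.

(* e n is the basis vector of index k + n *)
Definition e n : Kinf := MkKinf (lowfree_Xn (leq_addr n k)).

Lemma Kval_comb n (c : 'I_n -> F) i :
  (Kval (\sum_(j < n) c j *: e j))`_i = \sum_(j < n) c j * (i == (k + j)%N)%:R.
Proof.
rewrite -[Kval _]/(val (\sum_(j < n) c j *: e j)) linear_sum coef_sum.
apply: eq_bigr => j _.
by rewrite linearZ coefZ coefXn.
Qed.

Lemma e_span (p : Kinf) :
  p = \sum_(n < size (Kval p)) (Kval p)`_(k + n)%N *: e n.
Proof.
apply: val_inj; apply/polyP => i; rewrite /= Kval_comb.
have [ik|ki] := ltnP i k.
  rewrite big1 => [|n _]; first exact: (lowfreeP _ (KvalP p)).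
  by rewrite (ltn_eqF (ltn_addr _ ik)) mulr0.
have [ip|pi] := leqP (size (Kval p)) i.
  rewrite nth_default // big1 // => n _.
  have [E|_] := eqVneq i (k + n)%N; last by rewrite mulr0.
  by rewrite -E nth_default // mul0r.
have hn : (i - k < size (Kval p))%N by rewrite (leq_ltn_trans _ pi) ?leq_subr.
rewrite (bigD1 (Ordinal hn)) //= subnKC // eqxx mulr1 big1 ?addr0 // => n.
rewrite -val_eqE /= => ne; case: eqP => [E|]; last by rewrite mulr0.
by rewrite E addKn eqxx in ne.
Qed.

Lemma e_free n (c : 'I_n -> F) :
  \sum_(i < n) c i *: e i = 0 -> forall i, c i = 0.
Proof.
move=> E i; have := Kval_comb c (k + i)%N; rewrite E coef0.
rewrite (bigD1 i) //= eqxx mulr1 big1 ?addr0 // => j ji.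
by rewrite eqn_add2l eq_sym (val_eqE j i) (negbTE ji) mulr0.
Qed.

End Carrier.

Section IDD.
Variables (F : fieldType) (k m : nat).

(* the product of the basis vectors e_i and e_j; the division is exact *)
Definition table (i j : nat) : {poly F} :=
  if (m <= i)%N then (i`! %/ (i - m)`!)%N%:R *: 'X^(i + j - m)%N else 0.

Definition pidd (p q : {poly F}) : {poly F} :=
  \sum_(i < size p) \sum_(j < size q) (p`_i * q`_j) *: table i j.

Lemma tableE i j : table i j = ('X^i)^`(m) * 'X^j.
Proof.
rewrite /table derivnXn; case: leqP => mi.
  by rewrite -ffact_factd // scaler_nat mulrnAl -exprD addnC -addnBA // addnC.
by rewrite ffact_small // mulr0n mul0r.
Qed.

Lemma piddE p q : pidd p q = p^`(m) * q.
Proof.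
rewrite /pidd -[in RHS](coefK p) -[in RHS](coefK q) !poly_def linear_sum /= big_distrlr /=.
apply: eq_bigr => i _; apply: eq_bigr => j _.
by rewrite tableE derivnZ -scalerAl -scalerAr scalerA.
Qed.

Lemma pidd_lowfree (p q : Kinf F k) : pidd (Kval p) (Kval q) \in lowfree k.
Proof.
apply/lowfreeP => i ik; rewrite piddE coefM big1 // => j _.
have /lowfreeP -> := KvalP q; first by rewrite mulr0.
exact: leq_ltn_trans (leq_subr _ _) ik.
Qed.

Definition idd (p q : Kinf F k) : Kinf F k := MkKinf (pidd_lowfree p q).

Lemma iddE (p q : Kinf F k) : Kval (idd p q) = (Kval p)^`(m) * Kval q.
Proof. exact: piddE. Qed.

Lemma idd_e i j : Kval (idd (e F k i) (e F k j)) = table (k + i)%N (k + j)%N.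
Proof. by rewrite iddE tableE. Qed.

Lemma idd_is_bilinear : bilinear_for *:%R *:%R idd.
Proof.
split=> u c p q; apply: val_inj; rewrite !linearP /= !piddE.
  by rewrite derivnD derivnZ mulrDl -scalerAl.
by rewrite mulrDr -scalerAr.
Qed.

HB.instance Definition _ :=
  bilinear_isBilinear.Build F (Kinf F k) (Kinf F k) (Kinf F k) *:%R *:%R idd
    idd_is_bilinear.

End IDD.

(* IDD(K^k_oo, m, 0); for a realType R, R[i] is the field of complex numbers *)
Definition IDD (R : realType) (k m : nat) :
    {bilinear Kinf R[i] k -> Kinf R[i] k -> Kinf R[i] k} :=
  @idd R[i] k m.

(* Main.v *)
Require Import Defs.
From HB Require Import structures.
From mathcomp Require Import all_boot all_order all_algebra.
From mathcomp Require Import boolp classical_sets reals.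
From mathcomp Require Import complex.
From mathcomp Require Import ring.

(** Write D for the m-th derivative, so that the product is f g = D(f) g.
    Everything rests on D being onto, in characteristic 0, with a linear right
    inverse (antideriv) whose values vanish to order m at 0, hence lie in the
    carrier because k < m.

    Conservativity: left multiplications commute with one another, being
    multiplications by polynomials, so all but one term on the left of the
    identity cancel and leave D(D(a) D(b) x) y. The right-hand side is likewise
    D(D(a * b) x) y. It is therefore enough that D(a * b) = D(a) D(b), and
    a * b is defined as the antiderivative of D(a) D(b) (conservative_idd).

    Simplicity: since D is onto, a two-sided ideal I is stable under
    multiplication by every polynomial (ideal_mul). If it contains X^k h with h
    of degree r > 0, then it contains X^(m-1) h, as k <= m - 1, and then also
    the product of X^(m-1) h by X^k, which is X^k D(X^(m-1) h); the new cofactor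
    D(X^(m-1) h) has degree exactly r - 1. Descending to degree 0 puts X^k in
    I, and every element of the carrier is a polynomial multiple of X^k
    (ideal_full).

    Finally, X^m times X^k is m! X^k whereas X^k times X^m is 0, which excludes
    both commutativity and anticommutativity. *)

Set Implicit Arguments.
Unset Strict Implicit.
Unset Printing Implicit Defensive.

Import Order.TTheory GRing.Theory Num.Theory.
Local Open Scope classical_set_scope.
Local Open Scope ring_scope.

(** * Iterated antiderivatives *)

Section Antiderivative.
Variables (F : numFieldType) (m : nat).
Implicit Types p q : {poly F}.

Definition antideriv p : {poly F} :=
  'X^m * \poly_(i < size p) (p`_i / ((i + m) ^_ m)%:R).

Lemma coef_antideriv p i :
  (antideriv p)`_i = if (i < m)%N then 0 else p`_(i - m) / (i ^_ m)%:R.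
Proof.
rewrite coefXnM; case: ltnP => // mi; rewrite coef_poly subnK //.
by case: ltnP => // pi; rewrite nth_default // mul0r.
Qed.

Lemma antideriv_is_linear : linear antideriv.
Proof.
move=> c p q; apply/polyP => i; rewrite coefD coefZ !coef_antideriv.
by case: ltnP => _; rewrite ?mulr0 ?addr0 // coefD coefZ mulrDl mulrA.
Qed.

HB.instance Definition _ :=
  GRing.isLinear.Build F {poly F} {poly F} _ antideriv antideriv_is_linear.

Lemma antiderivK p : (antideriv p)^`(m) = p.
Proof.
apply/polyP => i; rewrite coef_derivn coef_antideriv ltnNge leq_addr /= addKn.
by rewrite -[LHS]mulr_natr divfK // pnatr_eq0 -lt0n ffact_gt0 leq_addr.
Qed.

Lemma antideriv_lowfree k p : (k <= m)%N -> antideriv p \in lowfree k.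
Proof.
by move=> km; apply/lowfreeP => i ik; rewrite coef_antideriv (leq_trans ik km).
Qed.

End Antiderivative.

Lemma size_derivn (F : numFieldType) (p : {poly F}) n :
  size p^`(n) = (size p - n)%N.
Proof.
have [pn|np] := leqP (size p) n.
  by rewrite derivn_poly0 // size_poly0; apply/esym/eqP; rewrite subn_eq0.
have -> : p^`(n) = \poly_(i < size p - n) (p`_(n + i) *+ (n + i) ^_ n).
  apply/polyP => i; rewrite coef_derivn coef_poly ltn_subRL.
  by case: ltnP => // pi; rewrite nth_default // mul0rn.
rewrite size_poly_eq // -mulr_natr mulf_neq0 // ?pnatr_eq0; last first.
  by rewrite -lt0n ffact_gt0 leq_addr.
have -> : (n + (size p - n).-1)%N = (size p).-1.
  by rewrite -!subn1 addnBA ?subn_gt0 // subnKC // ltnW.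
by rewrite -lead_coefE lead_coef_eq0 -size_poly_gt0 (leq_ltn_trans _ np).
Qed.

(** * The algebra over a field of characteristic 0 *)

Section Algebra.
Variables (F : numFieldType) (k m : nat).
Hypothesis km : (k < m)%N.
Implicit Types f g a b x y : Kinf F k.
Implicit Types h p q : {poly F}.

Local Notation mu := (@idd F k m : {bilinear Kinf F k -> Kinf F k -> Kinf F k}).

(** The antiderivative vanishes to order m at 0, so it lies in the carrier since
    k <= m. *)
Definition lift_deriv p : Kinf F k :=
  MkKinf (antideriv_lowfree p (ltnW km)).

Definition star a b : Kinf F k :=
  lift_deriv ((Kval a)^`(m) * (Kval b)^`(m)).

Lemma star_is_bilinear : bilinear_for *:%R *:%R star.
Proof.
split=> u c p q; apply: val_inj; rewrite !linearP /= -linearP.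
  by rewrite derivnD derivnZ mulrDl -scalerAl.
by rewrite derivnD derivnZ mulrDr -scalerAr.
Qed.

HB.instance Definition _ :=
  bilinear_isBilinear.Build F (Kinf F k) (Kinf F k) (Kinf F k) *:%R *:%R star
    star_is_bilinear.

(** Once D(a * b) is replaced by D(a) D(b), the two sides agree as polynomials in
    D(a), D(b), D(x), y and the derivatives D(D(a) x), D(D(b) x) and
    D(D(a) D(b) x), taken as independent commuting variables. *)
Lemma conservative_idd : conservative_alg mu.
Proof.
exists star => a b x y; apply: val_inj.
rewrite !(raddfD, raddfB, raddfN) /= !piddE antiderivK.
by rewrite !mulrA; ring.
Qed.

Lemma lowfree_Xk h : 'X^k * h \in lowfree k.
Proof. by apply/lowfreeP => i ik; rewrite coefXnM ik. Qed.

Definition Xk h : Kinf F k := MkKinf (lowfree_Xk h).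

Lemma Xk_surj f : exists h, f = Xk h.
Proof.
exists (drop_poly k (Kval f)); apply: val_inj; apply/polyP => i /=.
rewrite coefXnM; case: ltnP => [ik|ki]; last by rewrite coef_drop_poly subnK.
exact: (lowfreeP _ _ (KvalP f)).
Qed.

Section Ideal.
Variable I : set (Kinf F k).
Hypothesis idI : ideal mu I.

(** Multiplication by p is left multiplication by any g with D(g) = p. *)
Lemma ideal_mul p h : I (Xk h) -> I (Xk (p * h)).
Proof.
case: idI => _ _ mulI Ih.
have -> : Xk (p * h) = mu (lift_deriv p) (Xk h).
  by apply: val_inj; rewrite /= piddE antiderivK mulrCA.
by have [] := mulI (lift_deriv p) _ Ih.
Qed.

(** Unless h is constant, its degree drops by exactly one here, since X^(m-1)
    raises it by m - 1 and the m-th derivative lowers it by m. As k <= m - 1, the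
    element X^(m-1) h is a multiple of X^k h and so lies in the ideal; it is then
    multiplied on the right by X^k. *)
Lemma ideal_descent h : I (Xk h) -> I (Xk ('X^(m.-1) * h)^`(m)).
Proof.
case: idI => _ _ mulI /(ideal_mul 'X^(m.-1 - k)) Ih.
have -> : Xk ('X^(m.-1) * h)^`(m) = mu (Xk ('X^(m.-1 - k) * h)) (Xk 1).
  apply: val_inj; rewrite /= piddE mulr1 mulrA -exprD subnKC; first exact: mulrC.
  by rewrite -ltnS prednK // (leq_ltn_trans _ km).
by have [] := mulI (Xk 1) _ Ih.
Qed.

Lemma ideal_full h : h != 0 -> I (Xk h) -> I = [set: Kinf F k].
Proof.
move: {2}(size h) (leqnn (size h)) => n; elim: n => [|n IHn] in h *.
  by rewrite leqn0 size_poly_eq0 => ->.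
move=> hn h0 Ih; have [h1|h1] := leqP (size h) 1.
  apply/seteqP; split=> // f _; have [q ->] := Xk_surj f.
  rewrite (size1_polyC h1) in h0 Ih; rewrite polyC_eq0 in h0.
  (* h is a nonzero constant, hence divides q *)
  have -> : q = (h`_0)^-1 *: q * (h`_0)%:P.
    by rewrite mulrC mul_polyC scalerA divff ?scale1r.
  exact: ideal_mul.
have sD : size ('X^(m.-1) * h)^`(m) = (size h).-1.
  rewrite size_derivn mulrC size_mulXn //.
  by rewrite -{2}(prednK (leq_ltn_trans (leq0n k) km)) -addn1 subnDl subn1.
apply: (IHn _ _ _ (ideal_descent Ih)).
  by rewrite sD -ltnS prednK // (ltn_trans _ h1).
by rewrite -size_poly_gt0 sD -ltnS prednK // (ltn_trans _ h1).
Qed.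

End Ideal.

(** Take X^m / m! and X^k: their product is X^k, and it vanishes in the other
    order because X^k has degree k < m. *)
Lemma idd_asymmetric : exists x y, mu x y <> 0 /\ mu y x = 0.
Proof.
exists (lift_deriv 1), (Xk 1); split.
  move=> /(congr1 val) /=.
  rewrite piddE antiderivK mul1r mulr1 => /eqP.
  by rewrite -size_poly_eq0 size_polyXn.
apply: val_inj; rewrite /= piddE mulr1 derivn_poly0 ?mul0r // size_polyXn.
exact: km.
Qed.

Lemma simple_idd : simple_alg mu.
Proof.
split; first by have [x [y [xy _]]] := idd_asymmetric; exists x, y.
move=> I idI; have [|/existsNP[f /not_implyP[If f0]]] := pselect (I `<=` [set 0]).
  by left; apply/seteqP; split=> // f ->; case: idI.
right; have [h E] := Xk_surj f; rewrite E in If f0.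
apply: (ideal_full idI _ If); apply/eqP => h0; apply: f0.
by apply: val_inj; rewrite /= h0 mulr0.
Qed.

End Algebra.

Theorem mainTheorem2 (R : realType) (k m : nat) (hkm : (k < m)%N) :
  [/\ simple_alg (IDD R k m),
      conservative_alg (IDD R k m),
      ~ commutative (IDD R k m)
    & ~ anticommutative_alg (IDD R k m)].
Proof.
have [x [y [xy yx]]] := idd_asymmetric R[i] hkm.
split; [exact: simple_idd | exact: conservative_idd | |].
  by move=> C; apply: xy; rewrite -yx; apply: C.
by move=> C; apply: xy; rewrite -[RHS]oppr0 -yx; apply: C.
Qed.
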